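(* Let $\Gamma$ be a countable discrete group, and let $\mu$ be an admissible, finitely supported, lazy, symmetric probability measure on $\Gamma$ such that $(\Gamma,\mu)$ has the strong ratio limit property (SRLP). Then there exist a continuous map $\Phi\colon \Delta_{RL}\Gamma\to\partial_{ST}\Gamma$ from the ratio limit compactification to the space-time Martin boundary, and a map $\tilde\Phi\colon \Delta^{r}_{RL}\Gamma\to\partial_{ST}\Gamma$ from the reduced ratio limit compactification to the space-time Martin boundary which is a homeomorphism onto its image, such that $\Phi=\tilde\Phi\circ\Psi$, where $\Psi\colon\Delta_{RL}\Gamma\to\Delta^r_{RL}\Gamma$ is the canonical continuous surjection. Here $\Phi$ extends the map $\Gamma\to\partial_{ST}\Gamma$ sending $y$ to the point with space-time Martin kernel $(x,m)\mapsto R^mH(x,y)$, and $\tilde\Phi$ extends the map induced by it on $\Gamma/R_\mu$.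
   Context: Random walk: $e$ is the identity of $\Gamma$, $P(x,y)=\mu(x^{-1}y)$ and $P^n(x,y)=\mu^{*n}(x^{-1}y)$ (with $P^0(x,y)=\delta_{x,y}$). $\mu$ is admissible if its support generates $\Gamma$ as a semigroup, lazy if $\mu(e)>0$, symmetric if $\mu(x)=\mu(x^{-1})$ for all $x$. $R=(\limsup_n P^n(x,y)^{1/n})^{-1}$, which is independent of $x,y$. SRLP: for all $x,y\in\Gamma$ the limit $H(x,y)=\lim_{n\to\infty}P^n(x,y)/P^n(e,y)$ exists. Ratio limit compactification $\Delta_{RL}\Gamma$: the smallest compactification of $\Gamma$ (compact Hausdorff, containing $\Gamma$ as a discrete, open, dense subset) to which the functions $y\mapsto H(x,y)$, $x\in\Gamma$, extend continuously; the extended functions separate the points of $\Delta_{RL}\Gamma\setminus\Gamma$. Reduced version: $R_\mu=\{y\in\Gamma : H(x,y)=H(x,e)\ \forall x\in\Gamma\}$ is a subgroup of $\Gamma$, normal since $\mu$ is symmetric, and $y\mapsto H(x,y)$ factors through $\Gamma/R_\mu$. $\Delta^r_{RL}\Gamma$ is the smallest compact Hausdorff space containing a dense copy of the set $\Gamma/R_\mu$ to which the functions $yR_\mu\mapsto H(x,y)$, $x\in\Gamma$, extend continuously; equivalently the closure of $\{H(\cdot,y):y\in\Gamma\}$ in the topology of pointwise convergence of functions on $\Gamma$. $\Psi\colon\Delta_{RL}\Gamma\to\Delta^r_{RL}\Gamma$ is the continuous surjection extending the quotient map $\Gamma\to\Gamma/R_\mu$. Space-time boundary: $ST=\{(x,n)\in\Gamma\times\mathbb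 Z_{\ge0}: P^n(e,x)>0\}$. The space-time Markov chain on $ST$ has transition probabilities $P_{ST}((x,m),(y,n))=\delta_{m+1,n}\,\mu(x^{-1}y)$. Its Martin kernels with base point $(e,0)$ are $K_{ST}((x,m),(y,n))=P^{n-m}(x,y)/P^n(e,y)$ if $n\ge m$, and $0$ otherwise. The space-time Martin compactification $\Delta_{ST}\Gamma$ is the smallest compactification of $ST$ (compact Hausdorff, containing $ST$ as a discrete, open, dense subset) to which all functions $K_{ST}((x,m),\cdot)$ extend continuously, and $\partial_{ST}\Gamma=\Delta_{ST}\Gamma\setminus ST$. A sequence $(\xi_k)$ in $\partial_{ST}\Gamma$ converges to $\xi\in\partial_{ST}\Gamma$ iff $K_{ST}((x,m),\xi_k)\to K_{ST}((x,m),\xi)$ for all $(x,m)\in ST$, and points of $\partial_{ST}\Gamma$ are determined by their kernels. For fixed $y\in\Gamma$, the points $(y,n)$ converge as $n\to\infty$ to a point of $\partial_{ST}\Gamma$ with kernel $(x,m)\mapsto R^mH(x,y)$. *)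

(* Defs.v *)
From HB Require Import structures.
From mathcomp Require Import all_boot all_order all_algebra.
From mathcomp Require Import all_classical all_reals all_analysis.
Set Implicit Arguments.
Unset Strict Implicit.
Unset Printing Implicit Defensive.
Import Order.TTheory GRing.Theory Num.Theory.
Import numFieldNormedType.Exports.
Local Open Scope classical_set_scope.
Local Open Scope ring_scope.

Section RandomWalk.
Context {R : realType} {G : groupType}.
Implicit Types (mu : G -> R) (x y : G) (p q : G * nat).

Definition supp mu : set G := [set x | mu x != 0].

(* The sum is over the finite support of [mu]; [\sum_(x \in A)] is only
   meaningful for finitely supported summands. *)
Definition fin_supp_probability mu : Prop :=
  [/\ finite_set (supp mu), forall x, 0 <= mu x &
      \sum_(x \in [set: G]) mu x = 1].

(* The subsemigroup generated by the support is the whole group. *)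
Definition admissible mu : Prop :=
  smallest (fun A : set G => forall x y, A x -> A y -> A (x * y)%g) (supp mu)
  = [set: G].

Definition lazy mu : Prop := 0 < mu 1%g.

Definition symmetric_measure mu : Prop := forall x, mu x = mu (x^-1)%g.

Fixpoint convpow mu (n : nat) : G -> R :=
  if n is n'.+1 then
    fun x => \sum_(y \in [set: G]) convpow mu n' y * mu (y^-1 * x)%g
  else fun x => (x == 1%g)%:R.

Definition transition mu (n : nat) x y : R := convpow mu n (x^-1 * y)%g.

(* The limsup does not depend on the pair of points; it is taken at (e, e).
   The term of index 0 is [_ `^ 0 = 1]. *)
Definition inv_spectral_radius mu : R :=
  (limn_sup (fun n : nat => transition mu n 1%g 1%g `^ (n%:R^-1)))^-1.

Definition ratio_seq mu x y : nat -> R :=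
  fun n => transition mu n x y / transition mu n 1%g y.

Definition SRLP mu : Prop := forall x y, cvgn (ratio_seq mu x y).

Definition ratio_limit mu x y : R := limn (ratio_seq mu x y).

Definition ratio_subgroup mu : set G :=
  [set y | forall x, ratio_limit mu x y = ratio_limit mu x 1%g].

Definition left_coset (A : set G) y : set G := [set (y * r)%g | r in A].

Definition coset_space (A : set G) : Type := set_type (range (left_coset A)).

Definition coset_elt (A : set G) y : coset_space A :=
  SigSub (mem_set (imageT (left_coset A) y)).

Definition space_time mu : set (G * nat) :=
  [set p | 0 < transition mu p.2 1%g p.1].

Definition martin_kernel mu p q : R :=
  if (p.2 <= q.2)%N then transition mu (q.2 - p.2) p.1 q.1 / transition mu q.2 1%g q.1
  else 0.

End RandomWalk.

Section Compactifications.
Context {R : realType} {S : Type}.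
Implicit Types (X : topologicalType).

Definition continuous_extension X (i : S -> X) (f : S -> R) (g : X -> R) :
    Prop :=
  continuous g /\ forall s, g (i s) = f s.

Definition dense_compact X (i : S -> X) : Prop :=
  [/\ compact [set: X], hausdorff_space X, injective i & dense (range i)].

(* [S] is discrete and open in [X] iff its points are open in [X]. *)
Definition compactification X (i : S -> X) : Prop :=
  dense_compact i /\ forall s, open [set i s].

Definition is_smallest (C : forall X, (S -> X) -> Prop) X (i : S -> X) :
    Prop :=
  C X i /\
  forall (Y : topologicalType) (j : S -> Y), C Y j ->
    exists f : Y -> X, continuous f /\ forall s, f (j s) = i s.

End Compactifications.

Section Boundaries.
Context {R : realType} {G : groupType} (mu : G -> R).

Definition RL_compactification (X : topologicalType) (i : G -> X) : Prop :=
  is_smallest (fun Y (j : G -> Y) => compactification j /\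
    forall x, exists g : Y -> R,
      continuous_extension j (fun y => ratio_limit mu x y) g) i.

(* [ratio_limit mu x] is constant on the cosets of [ratio_subgroup mu], and
   [g] extends the function it induces on them. *)
Definition reduced_RL_compactification (X : topologicalType)
    (i : coset_space (ratio_subgroup mu) -> X) : Prop :=
  is_smallest (fun Y (j : coset_space (ratio_subgroup mu) -> Y) =>
    dense_compact j /\
    forall x, exists g : Y -> R,
      continuous g /\
      forall y, g (j (coset_elt (ratio_subgroup mu) y)) = ratio_limit mu x y) i.

Definition ST_compactification (Z : topologicalType)
    (i : set_type (space_time mu) -> Z) : Prop :=
  is_smallest (fun Y (j : set_type (space_time mu) -> Y) =>
    compactification j /\
    forall p : set_type (space_time mu), exists g : Y -> R,
      continuous_extension j (fun q => martin_kernel mu (\val p) (\val q)) g) i.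

Definition ST_boundary (Z : topologicalType)
    (i : set_type (space_time mu) -> Z) : topologicalType :=
  set_type (~` range i).

(* The Martin kernels extended to [Z] take the values [k] at [xi]; the
   extensions are unique since the image of [i] is dense. *)
Definition has_kernel (Z : topologicalType)
    (i : set_type (space_time mu) -> Z) (xi : ST_boundary i)
    (k : G -> nat -> R) : Prop :=
  forall p : set_type (space_time mu), exists g : Z -> R,
    continuous_extension i (fun q => martin_kernel mu (\val p) (\val q)) g /\
    g (\val xi) = k (\val p).1 (\val p).2.

Definition canonical_surjection (X : topologicalType) (iX : G -> X)
    (Xr : topologicalType) (iXr : coset_space (ratio_subgroup mu) -> Xr)
    (Psi : X -> Xr) : Prop :=
  [/\ continuous Psi, range Psi = [set: Xr] &
      forall y, Psi (iX y) = iXr (coset_elt (ratio_subgroup mu) y)].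

End Boundaries.

Definition homeomorphism_onto_image (X Y : topologicalType) (f : X -> Y) :
    Prop :=
  continuous f /\
  exists g : Y -> X, cancel f g /\ {within range f, continuous g}.

(* Main.v *)
Require Import Defs.
From HB Require Import structures.
From mathcomp Require Import all_boot all_order all_algebra finmap ring.
From mathcomp Require Import all_classical all_reals all_analysis.
Import Order.TTheory GRing.Theory Num.Theory.
Import numFieldNormedType.Exports.
Set Implicit Arguments.
Unset Strict Implicit.
Unset Printing Implicit Defensive.
Local Open Scope classical_set_scope.
Local Open Scope ring_scope.

(** A point of the space-time boundary is determined by its Martin kernel, and
    a point of the reduced ratio limit compactification is determined by the
    values [h x xi] there of the extended functions [H(x, .)]. So the map to be
    built is forced: [xi] must go to the boundary point with kernel
    [(x, m) |-> rho ^+ m * h x xi], with [rho] the inverse spectral radius.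
    Everything follows from comparing compact spaces through their coordinate
    maps into products of lines.

    Existence of the boundary point. For [xi] coming from a group element [y],
    cluster points of [(y, n)] as [n] grows have the right kernel
    ([vertical_boundary_point]). This rests on the asymptotics of the
    convolution powers [c n]: the SRLP gives a limit [phi x] of
    [c n x / c n 1], so that the finite sum defining [c n.+1 1] makes
    [c n.+1 1 / c n 1] converge. Laziness makes the limit positive, and the
    root test identifies it with the inverse of [rho] ([convpow_growth]). Hence
    [phi > 0], [H(x, y) = phi (x^-1 * y) / phi y], and the Martin kernels
    converge along [(y, n)] ([martin_kernel_cvg]). For general [xi], the image
    of the compact boundary in the product is closed and contains the required
    kernel for a dense set of [xi], hence for all of them; inverting the
    injective coordinate map of a compact space is continuous
    ([compact_embedding_lift]). The canonical surjection comes from the same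
    lemma, applied to the coordinates [H(x, .)] on both compactifications.

    Injectivity. Admissibility provides a space-time point above each [x], so
    the kernel of the image of [xi] determines all the [h x xi], hence [xi];
    an injective continuous map from a compact to a Hausdorff space is a
    homeomorphism onto its image.

    Finally, that coordinates determine points is a consequence of minimality
    ([smallest_embedding]): the image of the compactification under its
    coordinate map is itself a competitor, so it maps back onto the
    compactification, and this map inverts the coordinate map. For the
    competitor to qualify, its dense copy must be faithful. In the
    reduced case this says that [H(., y) = H(., z)] forces [y] and [z] into the
    same left coset ([coset_elt_eqP]). In the space-time case the indicators of
    the points of [ST] are added to the coordinates; they all vanish on the
    boundary, where the kernels alone therefore separate points. *)

(** * Compact spaces, dense subsets and subspaces *)

Lemma hausdorff_inj (X Y : topologicalType) (f : X -> Y) :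
  continuous f -> injective f -> hausdorff_space Y -> hausdorff_space X.
Proof.
move=> cf injf hY p q pq; apply/injf/hY => A B /cf pA /cf qB.
by have [x [Ax Bx]] := pq _ _ pA qB; exists (f x).
Qed.

Lemma set_val_continuous (X : topologicalType) (A : set X) :
  continuous (set_val : set_type A -> X).
Proof. exact: initial_continuous. Qed.

Lemma hausdorff_set_type (X : topologicalType) (A : set X) :
  hausdorff_space X -> hausdorff_space (set_type A).
Proof. exact: hausdorff_inj (@set_val_continuous _ _) val_inj. Qed.

Lemma compact_set_type (X : topologicalType) (A : set X) :
  compact A -> compact [set: set_type A].
Proof.
move=> cA F FF _.
have [x [Ax clx]] : A `&` cluster (set_val @ F) !=set0.
  apply: cA; rewrite /fmap /=; apply: filterS filterT => a _.
  exact: set_valP.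
exists (SigSub (mem_set Ax)); split=> // B C FB [_ [[U oU <-] Ux UC]].
have [y [[b Bb <-] Uy]] : (set_val @` B) `&` U !=set0.
  apply: clx; first by rewrite /fmap /=; apply: filterS FB => b Bb; exists b.
  exact: open_nbhs_nbhs.
by exists b; split=> //; apply: UC.
Qed.

Lemma compact_range (X Y : topologicalType) (f : X -> Y) :
  compact [set: X] -> continuous f -> compact (range f).
Proof. by move=> cX cf; apply: continuous_compact => //; exact: continuous_subspaceT. Qed.

Lemma closed_range (X Y : topologicalType) (f : X -> Y) :
  compact [set: X] -> hausdorff_space Y -> continuous f -> closed (range f).
Proof. by move=> cX hY cf; apply: compact_closed => //; exact: compact_range. Qed.

Lemma dense_subset_closed (X : topologicalType) (D C : set X) :
  dense D -> D `<=` C -> closed C -> C = [set: X].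
Proof.
move=> dD DC cC; apply/seteqP; split=> // x _; apply: contrapT => Cx.
have [y [ny Dy]] := dD _ (ex_intro _ x Cx) (closed_openC cC).
exact/ny/DC.
Qed.

(** In a Hausdorff space, unequal values can be separated on a nonempty open
    set of arguments, which the dense set must meet. *)
Lemma dense_eq (X Y : topologicalType) (D : set X) (f g : X -> Y) :
  dense D -> hausdorff_space Y -> continuous f -> continuous g ->
  {in D, f =1 g} -> f =1 g.
Proof.
move=> dD hY cf cg fg x; apply: contrapT => /eqP nfg.
move: hY; rewrite open_hausdorff => /(_ _ _ nfg) [[A B] /= [fA gB] [oA oB AB0]].
have [||y [[Ay By] /mem_set Dy]] := dD ((f @^-1` A) `&` (g @^-1` B)).
- by exists x; split; apply: set_mem.
- have oPA : open (f @^-1` A) by apply: open_comp => // z _; exact: cf.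
  have oPB : open (g @^-1` B) by apply: open_comp => // z _; exact: cg.
  exact: openI.
have : (A `&` B) (f y) by split=> //; rewrite fg.
by rewrite (eqP AB0).
Qed.

Lemma dense_range_comp (S : Type) (X Y : topologicalType) (i : S -> X) (f : X -> Y) :
  continuous f -> range f = [set: Y] -> dense (range i) -> dense (range (f \o i)).
Proof.
move=> cf sf di O [y Oy] oO.
have [x _ fx] : range f y by rewrite sf.
have [||x0 [Ox0 [s _ sx0]]] := di (f @^-1` O).
- by exists x; rewrite /= fx.
- by apply: open_comp => // z _; apply: cf.
- by exists (f x0); split=> //; exists s => //=; rewrite sx0.
Qed.

(** A compact space carries the topology induced by any continuous injection
    into a Hausdorff space: closed sets have compact, hence closed, images. *)
Lemma compact_embedding_continuous (A K W : topologicalType) (E : K -> W) (f : A -> K) :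
  compact [set: K] -> hausdorff_space W -> continuous E -> injective E ->
  continuous (E \o f) -> continuous f.
Proof.
move=> cK hW cE injE cEf; apply/continuous_closedP => C cC.
have -> : f @^-1` C = (E \o f) @^-1` (E @` C).
  by apply/seteqP; split=> a; [exists (f a)|case=> k Ck /injE fk; rewrite /= -fk].
move/continuous_closedP: cEf; apply; apply: compact_closed => //.
apply: continuous_compact; first exact: continuous_subspaceT.
exact: subclosed_compact cK _.
Qed.

(** Both the canonical surjection and the map into the space-time boundary are
    obtained in this way: [k] takes its values in the closed set [range E],
    because it does so on a dense set, and so it lifts through [E]. *)
Lemma compact_embedding_lift (S : Type) (A K W : topologicalType)
    (i : S -> A) (t : S -> K) (E : K -> W) (k : A -> W) :
  compact [set: K] -> hausdorff_space W -> continuous E -> injective E ->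
  dense (range i) -> continuous k -> (forall s, k (i s) = E (t s)) ->
  exists f : A -> K, [/\ continuous f, E \o f = k & forall s, f (i s) = t s].
Proof.
move=> cK hW cE injE di ck kE.
have kT : k @^-1` (range E) = [set: A].
  apply: dense_subset_closed di _ _; first by move=> _ [s _ <-]; exists (t s).
  by move/continuous_closedP: ck; apply; exact: closed_range.
have /choice[f Ef] : forall a, exists x, E x = k a.
  by move=> a; have : (k @^-1` range E) a by [rewrite kT]; case=> x _; exists x.
exists f; split.
- apply: compact_embedding_continuous cE injE _ => //.
  by rewrite (_ : E \o f = k) //; apply/funext.
- exact/funext.
- by move=> s; apply: injE; rewrite Ef.
Qed.

Lemma compact_embedding_homeomorphism (X Y : topologicalType) (f : X -> Y) (x0 : X) :
  compact [set: X] -> hausdorff_space Y -> continuous f -> injective f ->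
  homeomorphism_onto_image f.
Proof.
move=> cX hY cf injf; split=> //.
pose g y := xget x0 [set x | f x = y].
have fK : cancel f g.
  by move=> x; apply: injf; apply: (@xgetPex _ x0 [set z | f z = f x]); exists x.
exists g; split=> //; apply/subspace_sigL_continuousP.
apply: (@compact_embedding_continuous _ _ _ f) => //.
rewrite (_ : f \o sigL (range f) g = set_val); first exact: set_val_continuous.
by apply/funext => y; have [x _ fx] := set_valP y; rewrite /= /sigL set_valE /= -fx fK.
Qed.

(** * Products of lines and smallest compactifications *)

Lemma continuous_ptws (T : Type) (X K : topologicalType) (e : T -> X -> K) :
  (forall i, continuous (e i)) ->
  continuous (fun x => (fun i => e i x) : {ptws T -> K}).
Proof.
move=> ce x; apply/cvg_sup => i A [_ [[B oB <-] Bx] BA].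
by apply: filterS BA _; apply: ce; exact: open_nbhs_nbhs.
Qed.

Lemma ptws_eval_continuous (T : Type) (K : topologicalType) (i : T) :
  continuous (fun w : {ptws T -> K} => w i).
Proof. exact: (@proj_continuous {classic T} (fun=> K) i). Qed.

Lemma hausdorff_ptws (T : Type) (K : topologicalType) :
  hausdorff_space K -> hausdorff_space {ptws T -> K}.
Proof. by move=> hK; apply: (@hausdorff_product {classic T} (fun=> K)). Qed.

Lemma set_val_eval_continuous (T : Type) (K : topologicalType)
    (A : set {ptws T -> K}) (i : T) :
  continuous (fun w : set_type A => set_val w i).
Proof.
move=> w; apply: (@continuous_comp _ _ _ (@set_val _ A)
  (fun v : {ptws T -> K} => v i)); first exact: set_val_continuous.
exact: ptws_eval_continuous.
Qed.

Definition corestriction (X Y : Type) (f : X -> Y) (x : X) : set_type (range f) :=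
  SigSub (mem_set (imageT f x)).

Lemma corestriction_continuous (X Y : topologicalType) (f : X -> Y) :
  continuous f -> continuous (corestriction f).
Proof. by move=> cf; apply: continuous_comp_initial. Qed.

Lemma range_corestriction (X Y : Type) (f : X -> Y) :
  range (corestriction f) = [set: set_type (range f)].
Proof.
apply/seteqP; split=> // -[y yP] _; have [x _ fx] := set_mem yP.
by exists x => //; apply: val_inj.
Qed.

Lemma dense_compact_corestriction (S : Type) (X W : topologicalType)
    (i : S -> X) (E : X -> W) :
  dense_compact i -> hausdorff_space W -> continuous E -> injective (E \o i) ->
  dense_compact (corestriction E \o i).
Proof.
move=> [cX hX _ di] hW cE injEi; split.
- exact/compact_set_type/compact_range.
- exact: hausdorff_set_type.
- by move=> s t /(congr1 val) /injEi.
- apply: dense_range_comp (range_corestriction E) di.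
  exact: corestriction_continuous.
Qed.

(** If the image of [E] still belongs to the class [C], minimality of [X] sends
    it back to [X]; the resulting map is a left inverse of [E], since it is one
    on the dense set [range i]. *)
Lemma smallest_embedding (S : Type) (C : forall X : topologicalType, (S -> X) -> Prop)
    (X W : topologicalType) (i : S -> X) (E : X -> W) :
  is_smallest C i -> hausdorff_space X -> dense (range i) -> continuous E ->
  C _ (corestriction E \o i) -> injective E.
Proof.
move=> [_ minX] hX di cE /minX [f [cf fE]].
have fK : f \o corestriction E =1 id.
  apply: dense_eq di hX _ _ _.
  - by move=> x; apply: continuous_comp; [exact: corestriction_continuous|exact: cf].
  - by move=> x; exact: cvg_id.
  - by move=> _ /set_mem[s _ <-]; exact: fE.
move=> x y Exy; rewrite -(fK x) -(fK y) /=; congr f; exact: val_inj.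
Qed.

Lemma indicator_continuous (R : realType) (X : topologicalType) (x : X) :
  hausdorff_space X -> open [set x] ->
  continuous (fun y => (y == x)%:R : R).
Proof.
move=> hX ox y; rewrite /continuous_at; have [->|yx] := eqVneq y x.
  apply: cvg_near_cst.
  by apply: filterS (open_nbhs_nbhs (conj ox (erefl x))) => z ->; rewrite eqxx.
apply: cvg_near_cst.
have : nbhs y (~` [set x]).
  apply: open_nbhs_nbhs; split; last exact/eqP.
  exact/closed_openC/accessible_closed_set1/hausdorff_accessible.
by apply: filterS => z /eqP /negPf ->.
Qed.

(** A sequence that leaves every point of the discrete set [S] has a cluster
    point in the compact space [Z]; being isolated, the points of [S] cannot be
    cluster points, and continuity of the [k p] gives their values there. *)
Lemma escaping_sequence_boundary_point (R : realType) (S T : Type)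
    (Z : topologicalType) (i : S -> Z) (k : T -> Z -> R) (u : nat -> S) (l : T -> R) :
  compact [set: Z] -> injective i -> (forall s, open [set i s]) ->
  (forall p, continuous (k p)) -> (forall s, \forall n \near \oo, u n <> s) ->
  (forall p, k p (i (u n)) @[n --> \oo] --> l p) ->
  exists z : set_type (~` range i), forall p, k p (\val z) = l p.
Proof.
move=> cZ injI oI ck escu kl.
have [|z [_ clz]] := cZ ((i \o u) @ \oo); first exact: filterT.
have zI : (~` range i) z.
  move=> [s _ siz].
  have : nbhs z [set i s] by rewrite -siz; apply: open_nbhs_nbhs; split.
  have nis : ((i \o u) @ \oo) (~` [set i s]).
    by rewrite /fmap /=; apply: filterS (escu s) => n us /injI.
  by move=> /(clz _ _ nis) [w [nw /nw]].
exists (SigSub (mem_set zI)) => p /=.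
apply/esym/(@Rhausdorff R) => A B lA kB.
have [z' [Az' Bz']] := clz (k p @^-1` A) (k p @^-1` B) (kl p _ lA) (ck p z _ kB).
by exists (k p z').
Qed.

(** * Asymptotics of the convolution powers *)

(** Cesaro's theorem applied to [ln (a n.+1 / a n)], whose sum telescopes. *)
Lemma cvgn_root_ratio (R : realType) (a : R^nat) (l : R) :
  (forall n, 0 < a n) -> 0 < l -> a n.+1 / a n @[n --> \oo] --> l ->
  a n `^ n%:R^-1 @[n --> \oo] --> l.
Proof.
move=> a0 l0 al; rewrite -cvg_shiftS.
pose b n := ln (a n.+1 / a n).
have bl : b @ \oo --> ln l.
  by apply: (@cvg_comp _ _ _ _ (@ln R)) al _; exact: continuous_ln.
have bE n : series b n = ln (a n) - ln (a 0%N).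
  rewrite -[RHS]/([sequence ln (a n) - ln (a 0%N)]_n n) -(telescopeK (@ln R \o a)).
  by rewrite /series /=; apply: eq_bigr => k _; rewrite /b /telescope /= ln_div ?posrE.
have {}bl := cesaro bl.
have h0 : (fun n => n.+1%:R^-1 * ln (a 0%N)) @ \oo --> (0 : R).
  by rewrite -(mul0r (ln (a 0%N))); apply: cvgM; [exact: cvg_harmonic|exact: cvg_cst].
have bhl : (fun n => arithmetic_mean b n + n.+1%:R^-1 * ln (a 0%N)) @ \oo --> ln l.
  by rewrite -[ln l]addr0; apply: cvgD.
have := @cvg_comp _ _ _ _ (@expR R) _ _ _ bhl (@continuous_expR R (ln l)).
rewrite lnK ?posrE //; apply: cvg_trans; apply: near_eq_cvg; apply: nearW => n /=.
by rewrite /powR gt_eqF // /arithmetic_mean /= bE mulrBr subrK.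
Qed.

Section RandomWalk.
Context (R : realType) (G : groupType) (mu : G -> R).
Hypothesis mu_fin : finite_set (supp mu).
Hypothesis mu_ge0 : forall x, 0 <= mu x.

Let c := convpow mu.

Lemma convpowS n x :
  c n.+1 x = \sum_(s <- fset_set (supp mu)) c n (x * s^-1)%g * mu s.
Proof.
(* The increment s = y^-1 * x replaces the previous position y. *)
rewrite /c /= (reindex_fsbigT (fun s => x * s^-1)%g) /=; last first.
  exists (fun y => y^-1 * x)%g => y.
    by rewrite invgM invgK -mulgA mulVg mulg1.
  by rewrite invgM invgK mulgA mulgV mul1g.
under eq_fsbigr do rewrite invgM invgK -mulgA mulVg mulg1.
apply: fsbigTE => s sS; suff -> : mu s = 0 by rewrite mulr0.
by apply: contraNeq sS => s0; rewrite in_fset_set // mem_set.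
Qed.

Lemma convpow_ge0 n x : 0 <= c n x.
Proof.
elim: n x => [|n IH] x; first exact: ler0n.
by rewrite convpowS; apply: sumr_ge0 => s _; rewrite mulr_ge0.
Qed.

Lemma convpow1 x : c 1 x = mu x.
Proof.
rewrite /c /= (@fsbigTE _ _ _ _ [fset (1 : G)%g]%fset) => [|y].
  by rewrite big_seq_fset1 eqxx mul1r invg1 mul1g.
by rewrite inE => /negPf ->; rewrite mul0r.
Qed.

(** The walk may reach [x * y] by visiting [x] at time [n]. *)
Lemma convpow_mul n k x y : c n x * c k y <= c (n + k)%N (x * y)%g.
Proof.
elim: k y => [|k IH] y.
  rewrite addn0 {2}/c /=; case: eqP => [->|_]; first by rewrite mulr1 mulg1.
  by rewrite mulr0 convpow_ge0.
rewrite addnS !convpowS mulr_sumr; apply: ler_sum => s _.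
by rewrite mulrA -mulgA; apply: ler_wpM2r.
Qed.

(** The points reached with positive probability form a semigroup containing
    the support. *)
Lemma exists_convpow_gt0 x : admissible mu -> exists k, 0 < c k x.
Proof.
move=> adm; have : [set: G] x by [].
rewrite -adm => /(_ [set y | exists k, 0 < c k y]); apply; split.
- move=> y z [n yn] [k zk]; exists (n + k)%N.
  by apply: lt_le_trans (convpow_mul _ _ _ _); rewrite mulr_gt0.
- by move=> y /= yS; exists 1%N; rewrite convpow1 lt_neqAle eq_sym yS mu_ge0.
Qed.

Hypothesis mu_lazy : lazy mu.

Lemma convpow_lazy n x : c n x * mu 1%g <= c n.+1 x.
Proof. by have := convpow_mul n 1 x 1; rewrite convpow1 mulg1 addn1. Qed.

Lemma convpow_gt0_leq k n x : (k <= n)%N -> 0 < c k x -> 0 < c n x.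
Proof.
move=> /subnK <- ck; elim: (n - k)%N => [//|m IH].
by rewrite addSn; apply: lt_le_trans (convpow_lazy _ _); rewrite mulr_gt0.
Qed.

Lemma convpow_id_gt0 n : 0 < c n 1%g.
Proof. by apply: (@convpow_gt0_leq 0); rewrite // /c /= eqxx ltr01. Qed.

Hypothesis mu_adm : admissible mu.
Hypothesis mu_SRLP : SRLP mu.

(** The one-variable function behind the ratio limit: [H(x, y)] is a quotient
    of two of its values by [ratio_limitE]. *)
Definition relative_density x : R := ratio_limit mu x^-1%g 1%g.
Local Notation phi := relative_density.

Lemma relative_density_cvg x : c n x / c n 1%g @[n --> \oo] --> phi x.
Proof.
have -> : (fun n => c n x / c n 1%g) = ratio_seq mu x^-1%g 1%g.
  by apply/funext => n; rewrite /ratio_seq /transition invgK invg1 !mulg1.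
exact: mu_SRLP.
Qed.

(** The last step of a walk returning to the identity is one of finitely many
    increments [s], so [c n.+1 1 / c n 1] is a finite combination of
    ratios [c n s^-1 / c n 1], each of which converges. Laziness bounds the
    limit below by [mu 1], and the root test identifies it with the spectral
    radius. *)
Lemma convpow_growth : 0 < inv_spectral_radius mu /\
  c n.+1 1%g / c n 1%g @[n --> \oo] --> (inv_spectral_radius mu)^-1.
Proof.
pose lam := \sum_(s <- fset_set (supp mu)) phi s^-1%g * mu s.
have cvg_lam : c n.+1 1%g / c n 1%g @[n --> \oo] --> lam.
  under eq_fun do rewrite convpowS mulr_suml.
  under eq_fun do under eq_bigr do rewrite mul1g mulrAC.
  apply: cvg_big => [|s _].
  - move=> [x y]; apply: cvgD; [exact: cvg_fst|exact: cvg_snd].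
  - by apply: cvgM; [exact: relative_density_cvg|exact: cvg_cst].
have lam0 : 0 < lam.
  apply: lt_le_trans mu_lazy _.
  rewrite -(cvg_lim (@Rhausdorff R) cvg_lam); apply: limr_ge.
    by apply/cvg_ex; exists lam.
  by apply: nearW => n; rewrite ler_pdivlMr ?convpow_id_gt0 // mulrC convpow_lazy.
suff -> : inv_spectral_radius mu = lam^-1 by rewrite invrK invr_gt0.
rewrite /inv_spectral_radius /transition invg1; congr (_^-1).
have := cvgn_root_ratio convpow_id_gt0 lam0 cvg_lam.
by move=> /cvg_limn_inf_sup[_]; rewrite mul1g.
Qed.

Local Notation rho := (inv_spectral_radius mu).

Lemma convpow_shift_cvg m : c n 1%g / c (n + m)%N 1%g @[n --> \oo] --> rho ^+ m.
Proof.
have [rho0 grow] := convpow_growth.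
elim: m => [|m IH].
  rewrite expr0; apply: cvg_near_cst; apply: nearW => n.
  by rewrite addn0 divff // gt_eqF // convpow_id_gt0.
have shifted : (c (n + m).+1 1%g / c (n + m)%N 1%g)^-1 @[n --> \oo] --> rho.
  rewrite -[rho in X in _ --> X]invrK; apply: cvgV; first by rewrite gt_eqF // invr_gt0.
  by rewrite (cvg_shiftn m (fun n => c n.+1 1%g / c n 1%g)).
rewrite exprSr; apply: cvg_trans (cvgM IH shifted).
apply: near_eq_cvg; apply: nearW => n /=.
by rewrite addnS invf_div mulrA divfK // gt_eqF // convpow_id_gt0.
Qed.

(** Reaching [x] by returning to the identity and then spending the last [k]
    steps on a path to [x] costs only a bounded factor. *)
Lemma relative_density_gt0 x : 0 < phi x.
Proof.
have [rho0 _] := convpow_growth; have [k ck] := exists_convpow_gt0 x mu_adm.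
have low : c n 1%g / c (n + k)%N 1%g * c k x @[n --> \oo] --> rho ^+ k * c k x.
  by apply: cvgM; [exact: convpow_shift_cvg|exact: cvg_cst].
have upp : c (n + k)%N x / c (n + k)%N 1%g @[n --> \oo] --> phi x.
  by rewrite (cvg_shiftn k (fun n => c n x / c n 1%g)); exact: relative_density_cvg.
apply: (@lt_le_trans _ _ (rho ^+ k * c k x)); first by rewrite mulr_gt0 ?exprn_gt0.
apply: ler_cvg_to low upp _; apply: nearW => n.
rewrite mulrAC ler_pM2r ?invr_gt0 ?convpow_id_gt0 //.
by rewrite -{2}(mul1g x) convpow_mul.
Qed.

(** The kernel is a product of the three ratios [c n (x^-1 * y) / c n 1],
    [c n 1 / c (n + m) 1] and [c (n + m) 1 / c (n + m) y]. *)
Lemma martin_kernel_cvg x m y :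
  martin_kernel mu (x, m) (y, n) @[n --> \oo] --> rho ^+ m * (phi (x^-1 * y)%g / phi y).
Proof.
rewrite -(cvg_shiftn m (fun n => martin_kernel mu (x, m) (y, n))) /=.
have [k ck] := exists_convpow_gt0 y mu_adm.
have num := @relative_density_cvg (x^-1 * y)%g.
have den : (c (n + m)%N y / c (n + m)%N 1%g)^-1 @[n --> \oo] --> (phi y)^-1.
  apply: cvgV; first by rewrite gt_eqF // relative_density_gt0.
  by rewrite (cvg_shiftn m (fun n => c n y / c n 1%g)); exact: relative_density_cvg.
apply: cvg_trans (cvgM (@convpow_shift_cvg m) (cvgM num den)).
apply: near_eq_cvg; near=> n.
rewrite /martin_kernel /= leq_addl addnK /transition invg1 mul1g -/c.
have c1 : c n 1%g != 0 by rewrite gt_eqF // convpow_id_gt0.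
have c2 : c (n + m)%N 1%g != 0 by rewrite gt_eqF // convpow_id_gt0.
have c3 : c (n + m)%N y != 0.
  rewrite gt_eqF // (convpow_gt0_leq _ ck) // (leq_trans _ (leq_addr m n)) //.
  by near: n; exact: nbhs_infty_ge.
by rewrite /=; field; rewrite c1 c2 c3.
Unshelve. all: by end_near. Qed.

Lemma ratio_limitE x y : ratio_limit mu x y = phi (x^-1 * y)%g / phi y.
Proof.
apply: cvg_lim; first exact: Rhausdorff.
have := @martin_kernel_cvg x 0 y; rewrite expr0 mul1r; apply: cvg_trans.
by apply: near_eq_cvg; apply: nearW => n; rewrite /martin_kernel /= subn0.
Qed.

Lemma relative_density1 : phi 1%g = 1.
Proof.
have := @relative_density_cvg 1%g => /(cvg_lim (@Rhausdorff R)) <-.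
apply: lim_near_cst; first exact: Rhausdorff.
by apply: nearW => n; rewrite divff // gt_eqF // convpow_id_gt0.
Qed.

(** In this form the subgroup laws are immediate. *)
Lemma ratio_subgroupE r :
  ratio_subgroup mu r <-> forall x, phi (x * r)%g = phi x * phi r.
Proof.
have E x : ratio_limit mu x r = ratio_limit mu x 1%g <->
    phi (x^-1 * r)%g = phi x^-1%g * phi r.
  rewrite !ratio_limitE mulg1 relative_density1 divr1.
  have r0 : phi r != 0 by rewrite gt_eqF // relative_density_gt0.
  by split=> [<-|->]; rewrite ?divfK ?mulfK.
split=> [h x|h x]; last by apply/E/h.
by have /E := h x^-1%g; rewrite invgK.
Qed.

Lemma ratio_subgroup1 : ratio_subgroup mu 1%g. Proof. by []. Qed.

Lemma ratio_subgroupM r s :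
  ratio_subgroup mu r -> ratio_subgroup mu s -> ratio_subgroup mu (r * s)%g.
Proof.
move=> /ratio_subgroupE hr /ratio_subgroupE hs; apply/ratio_subgroupE => x.
by rewrite mulgA !hs hr mulrA.
Qed.

Lemma ratio_subgroupV r : ratio_subgroup mu r -> ratio_subgroup mu r^-1%g.
Proof.
move=> /ratio_subgroupE hr; apply/ratio_subgroupE => x.
have r0 : phi r != 0 by rewrite gt_eqF // relative_density_gt0.
have rV : phi r^-1%g * phi r = 1 by rewrite -hr mulVg relative_density1.
apply: (mulIf r0); rewrite -hr mulgVK.
by rewrite -mulrA rV mulr1.
Qed.

(** If [H(., y) = H(., z)], the functions [phi (w * z)] and [phi (w * y)] of [w]
    are proportional; evaluating at [w = y^-1] gives the factor and shows
    that [y^-1 * z] is multiplicative for [phi]. *)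
Lemma ratio_limit_eqP y z :
  (forall x, ratio_limit mu x y = ratio_limit mu x z) <-> ratio_subgroup mu (y^-1 * z)%g.
Proof.
have p0 x : phi x != 0 by rewrite gt_eqF // relative_density_gt0.
split=> [yz|/ratio_subgroupE h x].
- apply/ratio_subgroupE => x.
  have H w : phi (w * (y^-1 * z))%g / phi z = phi w / phi y.
    have := yz (y * w^-1)%g; rewrite !ratio_limitE invgM invgK mulgVK.
    by rewrite mulgA => <-.
  have := H 1%g; rewrite mul1g relative_density1 div1r => /(canRL (mulfVK (p0 z))) ->.
  by rewrite mulrA -(H x) mulfVK.
- rewrite !ratio_limitE.
  have -> w : phi (w * z)%g = phi (w * y)%g * phi (y^-1 * z)%g by rewrite -h mulgA mulgK.
  have := h y; rewrite mulgA mulgV mul1g => ->.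
  by rewrite -mulf_div divff // mulr1.
Qed.

Lemma coset_elt_eqP y z :
  coset_elt (ratio_subgroup mu) y = coset_elt (ratio_subgroup mu) z <->
  forall x, ratio_limit mu x y = ratio_limit mu x z.
Proof.
split=> [/(congr1 val) /= yz|/ratio_limit_eqP yz].
- apply/ratio_limit_eqP.
  have : left_coset (ratio_subgroup mu) z z.
    by exists 1%g; [exact: ratio_subgroup1|rewrite mulg1].
  by rewrite -yz => -[r Rr <-]; rewrite mulgA mulVg mul1g.
- apply: val_inj => /=; apply/seteqP; split=> _ [r Rr <-].
  + exists ((y^-1 * z)^-1 * r)%g; first by apply: ratio_subgroupM => //; exact: ratio_subgroupV.
    by rewrite invgM invgK !mulgA mulgV mul1g.
  + exists ((y^-1 * z) * r)%g; first exact: ratio_subgroupM.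
    by rewrite !mulgA mulgV mul1g.
Qed.
End RandomWalk.

(** * Coordinates on the compactifications *)

Section Coordinates.
Context (R : realType) (G : groupType) (mu : G -> R).
Hypothesis mu_fin : finite_set (supp mu).
Hypothesis mu_ge0 : forall x, 0 <= mu x.
Hypothesis mu_lazy : lazy mu.
Hypothesis mu_adm : admissible mu.
Hypothesis mu_SRLP : SRLP mu.

Local Notation rho := (inv_spectral_radius mu).
Local Notation ST := (set_type (space_time mu)).

Lemma coset_elt_surj (A : set G) (s : coset_space A) : exists y, coset_elt A y = s.
Proof. by have [y _ ys] := set_valP s; exists y; apply: val_inj. Qed.

Lemma reduced_RL_coordinates (X : topologicalType)
    (i : coset_space (ratio_subgroup mu) -> X) :
  reduced_RL_compactification i ->
  exists h : G -> X -> R, [/\ forall x, continuous (h x),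
    forall x y, h x (i (coset_elt _ y)) = ratio_limit mu x y &
    injective (fun xi => (fun x => h x xi) : {ptws G -> R})].
Proof.
move=> smallX; have [[dcX /choice[h hP]] _] := smallX.
have [_ hX injI dI] := dcX.
have ch x : continuous (h x) by have [] := hP x.
have hE x y : h x (i (coset_elt _ y)) = ratio_limit mu x y by have [_] := hP x.
exists h; split=> //.
have cE := continuous_ptws ch.
apply: (smallest_embedding smallX hX dI cE); split.
  apply: (dense_compact_corestriction dcX _ cE); first exact/hausdorff_ptws/Rhausdorff.
  move=> s t; have [y <-] := coset_elt_surj s; have [z <-] := coset_elt_surj t.
  move=> yz; apply/(coset_elt_eqP mu_fin) => // x.
  by rewrite -!hE; exact: (congr1 (fun w => w x) yz).
move=> x; exists (fun w => set_val w x); split; last by move=> y; exact: hE.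
exact: set_val_eval_continuous.
Qed.

(** The indicators of the points of [ST] are continuous because these points
    are isolated. Adding them to the kernels keeps [ST] discrete and open in
    the image, as a competitor to [Z] must be, and they do not help
    to tell boundary points apart, since they vanish there. *)
Lemma ST_boundary_coordinates (Z : topologicalType) (i : ST -> Z) :
  ST_compactification i ->
  exists k : ST -> Z -> R,
    (forall p, continuous_extension i (fun q => martin_kernel mu (\val p) (\val q)) (k p)) /\
    injective (fun xi : ST_boundary i => (fun p => k p (\val xi)) : {ptws ST -> R}).
Proof.
move=> smallZ; have [[[dcZ oI] /choice[k kP]] _] := smallZ.
have [_ hZ injI dI] := dcZ.
exists k; split=> //.
pose e (u : ST + ST) (z : Z) : R :=
  match u with inl s => (z == i s)%:R | inr p => k p z end.
have ce u : continuous (e u).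
  by case: u => [s|p]; [exact: indicator_continuous|have [] := kP p].
pose E z : {ptws (ST + ST)%type -> R} := fun u => e u z.
have cE : continuous E := continuous_ptws ce.
have isolated z s : E z (inl s) != 0 -> z = i s.
  by rewrite /E /e; have [//|_] := eqVneq z (i s); rewrite eqxx.
have injEi : injective (E \o i).
  move=> s t st; apply/injI/isolated.
  by rewrite -[E (i s)]/((E \o i) s) st /E /= eqxx oner_neq0.
have injE : injective E.
  apply: (smallest_embedding smallZ hZ dI cE); split; first split.
  - by apply: (dense_compact_corestriction dcZ _ cE injEi); exact/hausdorff_ptws/Rhausdorff.
  - move=> s.
    (* Only i s has a nonzero s-th indicator. *)
    have -> : [set (corestriction E \o i) s] =
        (fun w : set_type (range E) => set_val w (inl s)) @^-1` (~` [set 0]).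
      apply/seteqP; split=> [_ ->|w /eqP].
        suff : E (i s) (inl s) <> 0 by []; apply/eqP.
        by rewrite /E /= eqxx oner_neq0.
      have [z _ zw] := set_valP w; rewrite set_valE /= -zw => /isolated zs.
      by apply: val_inj; rewrite /= -zw zs.
    apply: open_comp; first by move=> w _; exact: set_val_eval_continuous.
    exact/closed_openC/closed_eq.
  - move=> p; exists (fun w => set_val w (inr p)); split; first exact: set_val_eval_continuous.
    by move=> q; have [_ <-] := kP p.
move=> xi xi' kk; apply/val_inj/injE/funext => -[s|p]; last exact: (congr1 (fun w => w p) kk).
have off (z : ST_boundary i) : (\val z == i s) = false.
  by apply/negP => /eqP zs; have := set_valP z; apply; exists s.
by rewrite /E /= !off.
Qed.

Lemma compact_ST_boundary (Z : topologicalType) (i : ST -> Z) :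
  ST_compactification i -> compact [set: ST_boundary i].
Proof.
move=> [[[[cZ _ _ _] oI] _] _]; apply: compact_set_type.
apply: subclosed_compact cZ _ => //; apply: open_closedC.
rewrite (_ : range i = \bigcup_s [set i s]); first by apply: bigcup_open.
by apply/seteqP; split=> [_ [s _ <-]|_ [s _ ->]]; exists s.
Qed.

(** The points [(y, n)] leave every point of [ST] as [n] grows. Laziness puts
    them in [ST] from some time [k0] on, hence the shift in the sequence. *)
Lemma vertical_boundary_point (Z : topologicalType) (i : ST -> Z) (k : ST -> Z -> R) (y : G) :
  ST_compactification i ->
  (forall p, continuous_extension i (fun q => martin_kernel mu (\val p) (\val q)) (k p)) ->
  exists xi : ST_boundary i,
    forall p, k p (\val xi) = rho ^+ (\val p).2 * ratio_limit mu (\val p).1 y.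
Proof.
move=> [[[[cZ _ injI _] oI] _] _] kP.
have [k0 ck0] := exists_convpow_gt0 mu_fin mu_ge0 y mu_adm.
have yST n : space_time mu (y, (n + k0)%N).
  rewrite /space_time /transition /= invg1 mul1g.
  by apply: convpow_gt0_leq ck0 => //; exact: leq_addl.
apply: (@escaping_sequence_boundary_point _ _ _ _ i k
  (fun n => SigSub (mem_set (yST n)))) => //.
- by move=> p; have [] := kP p.
- move=> s; near=> n => /(congr1 (fun p => (\val p).2)) /= ns.
  have : ((\val s).2 < n + k0)%N by rewrite ltn_addr //; near: n; exact: nbhs_infty_gt.
  by rewrite -ns ltnn.
- move=> p; have [_ kE] := kP p.
  rewrite [X in X @ _ --> _](_ : _ =
      fun n => martin_kernel mu (\val p) (y, (n + k0)%N)); last first.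
    by apply/funext => n; rewrite kE.
  rewrite (cvg_shiftn k0 (fun n => martin_kernel mu (\val p) (y, n))).
  rewrite ratio_limitE //; case: (\val p) => x m; exact: martin_kernel_cvg.
Unshelve. all: by end_near. Qed.

(** The reason why a space-time kernel determines every [H(x, .)], although
    only pairs [(x, m)] with [x] reachable at time [m] are available. *)
Lemma space_time_over x : exists p : ST, (\val p).1 = x.
Proof.
have [m cm] := exists_convpow_gt0 mu_fin mu_ge0 x mu_adm.
have xm : space_time mu (x, m) by rewrite /space_time /transition /= invg1 mul1g.
by exists (SigSub (mem_set xm)).
Qed.

End Coordinates.

(** * The maps into the space-time boundary *)

Unset Implicit Arguments.
Set Strict Implicit.

Theorem theorem3p6 (R : realType) (G : groupType) (mu : G -> R)
  (G_countable : countable [set: G])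
  (mu_prob : fin_supp_probability mu)
  (mu_adm : admissible mu)
  (mu_lazy : lazy mu)
  (mu_sym : symmetric_measure mu)
  (mu_SRLP : SRLP mu)
  (X : topologicalType) (iX : G -> X)
  (X_RL : RL_compactification mu iX)
  (Xr : topologicalType) (iXr : coset_space (ratio_subgroup mu) -> Xr)
  (Xr_RL : reduced_RL_compactification iXr)
  (Z : topologicalType) (iZ : set_type (space_time mu) -> Z)
  (Z_ST : ST_compactification iZ) :
  exists (Psi : X -> Xr) (Phi : X -> ST_boundary iZ)
         (Phir : Xr -> ST_boundary iZ),
    [/\ canonical_surjection iX iXr Psi,
        continuous Phi,
        homeomorphism_onto_image Phir &
        Phi = Phir \o Psi] /\
    (forall y : G,
       has_kernel (Phi (iX y)) (fun x m => inv_spectral_radius mu ^+ m * ratio_limit mu x y))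
    /\
    (forall y : G, Phir (iXr (coset_elt (ratio_subgroup mu) y)) = Phi (iX y)).
Proof.
have [mu_fin mu_ge0 _] := mu_prob.
have [rho0 _] := convpow_growth mu_fin mu_ge0 mu_lazy mu_SRLP.
have [h [ch hE injh]] := reduced_RL_coordinates mu_fin mu_ge0 mu_lazy mu_adm mu_SRLP Xr_RL.
have [k [kP injk]] := ST_boundary_coordinates Z_ST.
have [[[cXr hXr _ dXr] _] _] := Xr_RL.
have [[[[cX _ _ dX] _] /choice[g gP]] _] := X_RL.
have [[[[_ hZ _ _] _] _] _] := Z_ST.
pose coord xi : {ptws G -> R} := fun x => h x xi.
pose kernel (xi : ST_boundary iZ) : {ptws set_type (space_time mu) -> R} :=
  fun p => k p (\val xi).
have ckernel : continuous kernel.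
  apply: (@continuous_ptws _ (ST_boundary iZ) R (fun p xi => k p (\val xi))) => p xi.
  apply: continuous_comp; first exact: set_val_continuous.
  by have [ck _] := kP p; exact: ck.
(* H(x, .) on both compactifications: the coordinates agree on the group. *)
have [Psi [cPsi _ PsiE]] : exists Psi : X -> Xr, [/\ continuous Psi,
    coord \o Psi = (fun xi x => g x xi) &
    forall y, Psi (iX y) = iXr (coset_elt (ratio_subgroup mu) y)].
  apply: (@compact_embedding_lift _ _ _ {ptws G -> R}) => //.
  - exact/hausdorff_ptws/Rhausdorff.
  - exact: continuous_ptws.
  - by apply: continuous_ptws => x; have [] := gP x.
  - by move=> y; apply/funext => x; rewrite /coord hE; have [_ ->] := gP x.
have /choice[b bP] := fun y =>
  vertical_boundary_point mu_fin mu_ge0 mu_lazy mu_adm mu_SRLP y Z_ST kP.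
have /choice[rep repK] := @coset_elt_surj G (ratio_subgroup mu).
(* The kernel prescribed at xi is realized at the cosets, by b (rep s). *)
have [Phir [cPhir kernelPhir _]] : exists Phir : Xr -> ST_boundary iZ,
    [/\ continuous Phir,
    kernel \o Phir = (fun xi p => inv_spectral_radius mu ^+ (\val p).2 * h (\val p).1 xi) &
    forall s, Phir (iXr s) = b (rep s)].
  apply: (@compact_embedding_lift _ _ _ {ptws set_type (space_time mu) -> R}) => //.
  - exact: compact_ST_boundary.
  - exact/hausdorff_ptws/Rhausdorff.
  - apply: continuous_ptws => p xi.
    by apply: cvgM; [exact: cvg_cst|exact: ch].
  - by move=> s; apply/funext => p; rewrite /kernel bP -[in LHS](repK s) hE.
have injPhir : injective Phir.
  move=> xi xi' eq_Phir; apply: injh; apply/funext => x.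
  have [p <-] := space_time_over mu_fin mu_ge0 mu_adm x.
  have : (kernel \o Phir) xi p = (kernel \o Phir) xi' p by rewrite /= eq_Phir.
  by rewrite kernelPhir; apply: mulfI; rewrite gt_eqF // exprn_gt0.
exists Psi, (Phir \o Psi), Phir; split; [split|split] => //.
- split=> //; apply: (dense_subset_closed dXr); last exact: closed_range.
  by move=> _ [s _ <-]; exists (iX (rep s)) => //; rewrite PsiE repK.
- by move=> xi; apply: continuous_comp; [exact: cPsi|exact: cPhir].
- apply: compact_embedding_homeomorphism => //.
    exact: iXr (coset_elt _ 1%g).
  exact: hausdorff_set_type.
- move=> y p; exists (k p); split; first exact: kP.
  have -> : k p (\val ((Phir \o Psi) (iX y))) = (kernel \o Phir) (Psi (iX y)) p by [].
  by rewrite kernelPhir PsiE hE.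
- by move=> y; rewrite /= PsiE.
Qed.
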